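(* Let $(U,\mathcal U)$ be a measurable space and let $\mu,\nu$ be $\sigma$-finite, lower continuous monotone measures on $(U,\mathcal U)$, with $\nu$ null-additive. Let $\{U_n\}_{n=1}^\infty\subset\mathcal U$ be a sequence with $U_1\subset U_2\subset\cdots$, $\bigcup_{n}U_n=U$, and $\mu(U_n)<\infty$, $\nu(U_n)<\infty$ for every $n$. Suppose that $(\mu,\nu)$ has the decomposition property with respect to a family $\{A_\alpha\}_{\alpha\in\mathbb Q^+}$ of measurable sets and that $$\lim_{\alpha\to\infty}\max\{\mu(A_\alpha\cap U_n),\nu(A_\alpha\cap U_n)\}=0\qquad\text{for each }n.$$ Then there is a measurable function $f\colon U\to[0,\infty]$, finite a.e.$[\nu]$ (i.e. $\nu(\{f=\infty\})=0$), such that $$\mu(A)=\int_A f\,d\nu\qquad\text{for all }A\in\mathcal U,$$ where the integral is the Choquet integral. Moreover, $f$ is unique a.e.$[\nu]$: if $g$ is another such function, then $\nu(\{f\ne g\})=0$.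
   Context: A measurable space $(U,\mathcal U)$ is a nonempty set $U$ with a $\sigma$-algebra $\mathcal U$ of subsets. A function $f\colon U\to[0,\infty]$ is measurable if $\{f\ge\alpha\}\in\mathcal U$ for every $\alpha\in[0,\infty]$. A monotone measure on $(U,\mathcal U)$ is a set function $\mu\colon\mathcal U\to[0,\infty]$ with $\mu(\emptyset)=0$ and $\mu(A)\le\mu(B)$ whenever $A\subset B$, $A,B\in\mathcal U$. It is: - $\sigma$-finite if there is an increasing sequence $\{U_n\}\subset\mathcal U$ with union $U$ and $\mu(U_n)<\infty$ for each $n$; - lower continuous if $\mu(A)=\lim_{n\to\infty}\mu(A_n)$ for every increasing sequence $\{A_n\}\subset\mathcal U$ with $\bigcup_n A_n=A$; - null-additive if $\mu(A\cup N)=\mu(A)$ for all $A,N\in\mathcal U$ with $\mu(N)=0$. The Choquet integral of a nonnegative measurable $f$ with respect to a monotone measure $\nu$ on $A\in\mathcal U$ is $\int_A f\,d\nu=\int_0^\infty \nu(\{f\ge\alpha\}\cap A)\,d\alpha$ (improper Riemann integral, with value in $[0,\infty]$). $\mathbb Q^+$ denotes the set of all nonnegative rational numbers (including $0$). Decomposition property: for monotone measures $\mu,\nu$ on $(U,\mathcal U)$, the ordered pair $(\mu,\nu)$ has the decomposition property with respect to $\{A_\alpha\}_{\alpha\in\mathbb Q^+}$ if $\{A_\alpha\}_{\alpha\in\mathbb Q^+}$ is a decreasing family of measurable sets (i.e. $A_\beta\subset A_\alpha$ for $\alpha<\beta$) with $A_0=U$ such that $$\alpha\big(\nu(A\cap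 A_\alpha)-\nu(A\cap A_\beta)\big)\le \mu(A\cap A_\alpha)-\mu(A\cap A_\beta)\le \beta\big(\nu(A\cap A_\alpha)-\nu(A\cap A_\beta)\big)$$ for every $A\in\mathcal U$ with $\mu(A)<\infty$ and $\nu(A)<\infty$ and all $\alpha,\beta\in\mathbb Q^+$ with $\alpha<\beta$. Limits as $\alpha\to\infty$ are taken along $\alpha\in\mathbb Q^+$. *)

(* Defs.v *)
From HB Require Import structures.
From mathcomp Require Import all_boot all_order all_algebra.
From mathcomp Require Import all_classical all_reals all_analysis.
From mathcomp Require Import measurable_realfun.

Set Implicit Arguments.
Unset Strict Implicit.
Unset Printing Implicit Defensive.

Import Order.TTheory GRing.Theory Num.Theory.
Import numFieldNormedType.Exports.

Local Open Scope classical_set_scope.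
Local Open Scope ring_scope.
Local Open Scope ereal_scope.

(** Set functions are total on [set U]; only their values on measurable sets
    are ever constrained or used. The types [measurableType d] are pointed,
    so that measurable spaces are nonempty. *)
Section monotone_measures.
Context {R : realType} {d : measure_display} {U : measurableType d}.
Implicit Types mu nu : set U -> \bar R.

Definition monotone_measure mu : Prop :=
  [/\ mu set0 = 0,
      forall A, measurable A -> 0 <= mu A &
      forall A B, measurable A -> measurable B -> A `<=` B -> mu A <= mu B].

(** Unlike in the library's [sigma_finite], the exhausting sequence must be
    increasing: this matters because [mu] need not be subadditive. *)
Definition mm_sigma_finite mu : Prop :=
  exists F : (set U)^nat,
    [/\ forall n, measurable (F n),
        nondecreasing_seq F,
        \bigcup_n F n = [set: U] &
        forall n, mu (F n) < +oo].

Definition lower_continuous mu : Prop :=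
  forall F : (set U)^nat, (forall n, measurable (F n)) ->
    nondecreasing_seq F ->
    mu (F n) @[n --> \oo] --> mu (\bigcup_n F n).

Definition null_additive mu : Prop :=
  forall A N, measurable A -> measurable N -> mu N = 0 -> mu (A `|` N) = mu A.

(** The families indexed by the nonnegative rationals are represented by
    functions on [rat], only used at nonnegative arguments. *)
Definition decomposition_property mu nu (A_ : rat -> set U) : Prop :=
  [/\ forall a : rat, (0 <= a)%R -> measurable (A_ a),
      forall a b : rat, (0 <= a)%R -> (a < b)%R -> A_ b `<=` A_ a,
      A_ 0%R = [set: U] &
      forall A, measurable A -> mu A < +oo -> nu A < +oo ->
      forall a b : rat, (0 <= a)%R -> (a < b)%R ->
        (ratr a)%:E * (nu (A `&` A_ a) - nu (A `&` A_ b))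
          <= mu (A `&` A_ a) - mu (A `&` A_ b) /\
        mu (A `&` A_ a) - mu (A `&` A_ b)
          <= (ratr b)%:E * (nu (A `&` A_ a) - nu (A `&` A_ b))].

End monotone_measures.

Section riemann_integral.
Context {R : realType}.
Implicit Types (h : R -> \bar R) (a b : R) (s : seq R).

(** [itv_partition a b s] means [a < s_0 < s_1 < ... < last s = b]; the point
    [a] is not listed in [s]. *)
Definition lower_darboux_sum a b h s : \bar R :=
  let x := nth b (a :: s) in
  \sum_(0 <= i < size s) ereal_inf (h @` `[x i, x i.+1]) * (x i.+1 - x i)%:E.

Definition upper_darboux_sum a b h s : \bar R :=
  let x := nth b (a :: s) in
  \sum_(0 <= i < size s) ereal_sup (h @` `[x i, x i.+1]) * (x i.+1 - x i)%:E.

Definition lower_darboux_integral a b h : \bar R :=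
  ereal_sup [set lower_darboux_sum a b h s | s in itv_partition a b].

Definition upper_darboux_integral a b h : \bar R :=
  ereal_inf [set upper_darboux_sum a b h s | s in itv_partition a b].

(** [v] is the improper Riemann integral of [h] over [(0, +oo)], i.e. the limit
    of the Riemann integrals over [[a, b]] as [a] tends to [0] from the right
    and [b] to [+oo]. The integral is improper at [0] too, because the value at
    [0] of the integrands below may be infinite when all the others are finite.
    Integrability on [[a, b]] is required only for [a] small and [b] large: a
    nonincreasing [h] that is infinite up to the point [a] and finite
    beyond it has distinct Darboux integrals over [[a, b]], but has lower and
    upper integrals both equal to [+oo] as soon as [a] is made smaller. *)
Definition is_improper_riemann_integral h (v : \bar R) : Prop :=
  (\forall a \near (0 : R)^'+ & b \near +oo%R,
     lower_darboux_integral a b h = upper_darboux_integral a b h) /\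
  lower_darboux_integral ab.1 ab.2 h
    @[ab --> filter_prod (0 : R)^'+ +oo%R] --> v.

End riemann_integral.

Section choquet_integral.
Context {R : realType} {d : measure_display} {U : measurableType d}.
Implicit Types (mu nu : set U -> \bar R) (A : set U) (f : U -> \bar R).

Definition is_choquet_integral nu A f (v : \bar R) : Prop :=
  is_improper_riemann_integral
    (fun a : R => nu ([set x | a%:E <= f x] `&` A)) v.

Lemma is_choquet_integral_unique nu A f v w :
  is_choquet_integral nu A f v -> is_choquet_integral nu A f w -> v = w.
Proof. by move=> [_ +] [_]; exact: cvg_unique. Qed.

(** [f] is a density of [mu] with respect to [nu], in the sense of the Choquet
    integral, which is finite [nu]-almost everywhere. *)
Definition choquet_derivative mu nu f : Prop :=
  [/\ forall x, 0 <= f x,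
      measurable_fun [set: U] f,
      nu [set x | f x = +oo] = 0 &
      forall A, measurable A -> is_choquet_integral nu A f (mu A)].

End choquet_integral.

(* Main.v *)
Require Import Defs.
From mathcomp Require Import all_boot all_order all_algebra.
From mathcomp Require Import all_classical all_reals all_analysis.
From mathcomp Require Import measurable_realfun lra.

Set Implicit Arguments.
Unset Strict Implicit.
Unset Printing Implicit Defensive.

Import Order.TTheory GRing.Theory Num.Theory.
Import numFieldNormedType.Exports.
Local Open Scope classical_set_scope.
Local Open Scope ring_scope.
Local Open Scope ereal_scope.

(** Heuristically, [A_ q] is the superlevel set of the density at height [q], so
    the density must be [f x = sup {q | x \in A_ q}]: the sets [{f >= a}] and
    [A_ q] are then interleaved, and only the integral formula is at stake.

    Fix [A] with [mu A] and [nu A] finite, let [m q] and [h q] be the values of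
    [mu] and [nu] on [A `&` A_ q], and put [G q = m q - q * h q]. Subtracting
    [q * h q - r * h r] from the decomposition inequalities turns them into
    [(r - q) * h r <= G q - G r <= (r - q) * h q] for [q < r], which says that
    [G] is a primitive of [- h]. Hence the Riemann sums of [a |-> nu ({f >= a}
    `&` A)] are trapped between increments of [G]. Since [G 0 = mu A], and since
    [0 <= G q <= m q] tends to [0] when [A] is contained in some [U_ n], the
    integral is [mu A] ([monotone_integral_decomposition] and
    [choquet_level_density]).

    The integrand is nonincreasing, so its improper Riemann integral exists and
    is the supremum of its sums at right endpoints
    ([monotone_improper_riemann_integral]). Each such sum involves finitely many
    values of the integrand, so the supremum passes to increasing limits without
    any convergence theorem for integrals. With lower continuity of [mu] and
    [nu], this extends the formula from the sets [A `&` U_ n] to every measurable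
    [A] ([choquet_derivative_level_density]).

    For uniqueness, let [E] be the part of [{f <= q} `&` {r <= g}] inside [U_ n],
    with [q < r]. Integrating [f] and [g] over [E] gives
    [r * nu E <= mu E <= q * nu E] with [nu E] finite, so [nu E = 0]. The set
    [{f < g}] is a countable union of such sets, and null-additivity together with lower
    continuity makes countable unions of null sets null. *)

(** * Riemann sums of nonincreasing functions *)

Section riemann_sums.
Context {R : realType}.
Implicit Types (h : R -> \bar R) (a b x : R) (s t : seq R).

(** On a nonincreasing function the infimum over a closed interval is the value at
    the right endpoint and the supremum is the value at the left one. This form
    of the Darboux sums is local in the function and lends itself to induction on
    the subdivision. *)
Fixpoint right_sum h a s : \bar R :=
  if s is x :: s' then h x * (x - a)%:E + right_sum h x s' else 0.

Fixpoint left_sum h a s : \bar R :=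
  if s is x :: s' then h a * (x - a)%:E + left_sum h x s' else 0.

Fixpoint grid a (e : R) (n : nat) : seq R :=
  if n is n'.+1 then (a + e)%R :: grid (a + e)%R e n' else [::].

Lemma lower_darboux_sumE h a b s :
  {homo h : x y / (x <= y)%R >-> y <= x} -> path <%R a s ->
  lower_darboux_sum a b h s = right_sum h a s.
Proof.
move=> hni; elim: s a => [a _|x s ih a /= /andP[ax xs]].
  by rewrite /lower_darboux_sum /= big_nil.
rewrite -(ih _ xs) /lower_darboux_sum /= big_nat_recl//=; congr (_ * _ + _).
apply/eqP; rewrite eq_le; apply/andP; split.
  by apply: ereal_inf_lbound; exists x => //=; rewrite in_itv/= lexx ltW.
by apply: le_ereal_inf_tmp => _ [y /= + <-]; rewrite in_itv/= => /andP[_ /hni].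
Qed.

Lemma upper_darboux_sumE h a b s :
  {homo h : x y / (x <= y)%R >-> y <= x} -> path <%R a s ->
  upper_darboux_sum a b h s = left_sum h a s.
Proof.
move=> hni; elim: s a => [a _|x s ih a /= /andP[ax xs]].
  by rewrite /upper_darboux_sum /= big_nil.
rewrite -(ih _ xs) /upper_darboux_sum /= big_nat_recl//=; congr (_ * _ + _).
apply/eqP; rewrite eq_le; apply/andP; split.
  by apply: ge_ereal_sup => _ [y /= + <-]; rewrite in_itv/= => /andP[/hni].
by apply: ereal_sup_ubound; exists a => //=; rewrite in_itv/= lexx ltW.
Qed.

Lemma right_sum_ge0 h a s : (forall x, 0 <= h x) -> path <=%R a s ->
  0 <= right_sum h a s.
Proof.
move=> h0; elim: s a => //= x s ih a /andP[ax xs].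
by rewrite adde_ge0 ?ih// mule_ge0// lee_fin subr_ge0.
Qed.

Lemma left_sum_ge0 h a s : (forall x, 0 <= h x) -> path <=%R a s ->
  0 <= left_sum h a s.
Proof.
move=> h0; elim: s a => //= x s ih a /andP[ax xs].
by rewrite adde_ge0 ?ih// mule_ge0// lee_fin subr_ge0.
Qed.

Lemma le_right_sum h1 h2 a s : (forall x, h1 x <= h2 x) -> path <=%R a s ->
  right_sum h1 a s <= right_sum h2 a s.
Proof.
move=> h12; elim: s a => //= x s ih a /andP[ax xs].
by rewrite leeD ?ih// lee_wpmul2r// lee_fin subr_ge0.
Qed.

Lemma right_sum_rcons h a s b : right_sum h a (rcons s b) =
  right_sum h a s + h b * (b - last a s)%:E.
Proof.
elim: s a => /= [a|x s ih a]; first by rewrite adde0 add0e.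
by rewrite ih addeA.
Qed.

Lemma le_last_path a s : path <=%R a s -> (a <= last a s)%R.
Proof. by elim: s a => //= x s ih a /andP[ax /ih]; exact: le_trans. Qed.

(** A lower sum is below an upper sum even for unrelated subdivisions. The
    induction walks along both at once: the one whose first point comes first is
    shortened, and the first interval of the other is cut at that point. Cutting
    may leave an interval of length zero, whence subdivisions that are only
    nondecreasing. *)
Lemma le_right_left_sum h a s t : (forall x, 0 <= h x) ->
  {homo h : x y / (x <= y)%R >-> y <= x} ->
  path <=%R a s -> path <=%R a t -> last a s = last a t ->
  right_sum h a s <= left_sum h a t.
Proof.
move=> h0 hni; have [n] := ubnP (size s + size t)%N.
elim: n a s t => // n ih a [|x s] t sz.
  by move=> _ pt _ /=; exact: left_sum_ge0.
case: t sz => [|y t] sz.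
  move=> /= /andP[ax xs] _ lxs.
  (* Only one subdivision is exhausted: the remaining intervals of the other one
     are degenerate. *)
  have right_sum0 z r : path <=%R z r -> last z r = z -> right_sum h z r = 0.
    elim: r z => //= w r ihr z /andP[zw wr] lwr.
    have wz : w = z.
      by apply/eqP; rewrite eq_le zw andbT -[leRHS]lwr le_last_path.
    by rewrite wz subrr mule0 add0e ihr// -?wz// lwr.
  have := right_sum0 a (x :: s); rewrite /= ax xs => -> //.
move=> /= /andP[ax xs] /andP[ay yt] lst.
have [xy|/ltW yx] := leP x y.
  have -> : (y - a)%:E = (x - a)%:E + (y - x)%:E.
    by rewrite -EFinD; congr EFin; lra.
  rewrite ge0_muleDr ?lee_fin ?subr_ge0// -addeA.
  apply: leeD; first by rewrite lee_wpmul2r ?lee_fin ?subr_ge0 ?hni.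
  apply: (@le_trans _ _ (left_sum h x (y :: t))).
    by apply: ih => //=; rewrite ?xy//; move: sz => /=;
      rewrite addSn addnS !ltnS.
  by rewrite /= leeD2r// lee_wpmul2r ?lee_fin ?subr_ge0 ?hni.
have -> : (x - a)%:E = (y - a)%:E + (x - y)%:E.
  by rewrite -EFinD; congr EFin; lra.
rewrite ge0_muleDr ?lee_fin ?subr_ge0// -addeA.
apply: leeD; first by rewrite lee_wpmul2r ?lee_fin ?subr_ge0 ?hni.
apply: (ih y (x :: s) t) => //=; last by rewrite yx.
by move: sz => /=; rewrite !addSn addnS !ltnS.
Qed.

Lemma path_grid a (e : R) n : (0 < e)%R -> path <%R a (grid a e n).
Proof. by move=> e0; elim: n a => //= n ih a; rewrite ltrDl e0 ih. Qed.

Lemma last_grid a (e : R) n : last a (grid a e n) = (a + e *+ n)%R.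
Proof. by elim: n a => [|n ih] a/=; rewrite ?addr0// ih mulrS addrA. Qed.

(** The two sums telescope against each other on a regular grid. The identity is
    written additively because [h] may take infinite values. *)
Lemma left_sum_grid h a (e : R) n : (forall x, 0 <= h x) ->
  left_sum h a (grid a e n) + h (a + e *+ n)%R * e%:E =
  right_sum h a (grid a e n) + h a * e%:E.
Proof.
move=> h0; elim: n a => [|n ih] a /=; first by rewrite addr0.
have ae : (a + e - a = e)%R by lra.
rewrite ae mulrS addrA -addeA ih addeCA addeC -!addeA addeCA; congr (_ + _).
by rewrite addeC.
Qed.

End riemann_sums.

(** * The improper Riemann integral of a nonincreasing function *)

Section monotone_integral.
Context {R : realType}.
Implicit Types (h : R -> \bar R) (a b x : R) (s t : seq R).

(** The right endpoint of the domain is not fixed: it is the last point of the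
    subdivision, so the supremum runs over all compact subintervals of
    [(0, +oo)] at the same time. *)
Definition monotone_integral h : \bar R :=
  ereal_sup [set right_sum h p.1 p.2 |
             p in [set p : R * seq R | (0 < p.1)%R /\ path <%R p.1 p.2]].

Lemma right_sum_le_monotone_integral h a s : (0 < a)%R -> path <%R a s ->
  right_sum h a s <= monotone_integral h.
Proof. by move=> a0 ps; apply: ereal_sup_ubound; exists (a, s). Qed.

Lemma monotone_integral_le h (c : \bar R) :
  (forall a s, (0 < a)%R -> path <%R a s -> right_sum h a s <= c) ->
  monotone_integral h <= c.
Proof.
by move=> H; apply: ge_ereal_sup => _ [[a s] [/= a0 ps] <-]; exact: H.
Qed.

Lemma path_ltW a s : path <%R a s -> path <=%R a s.
Proof. by apply: sub_path => x y; exact: ltW. Qed.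

Variable h : R -> \bar R.
Hypothesis h0 : forall x, 0 <= h x.
Hypothesis hni : {homo h : x y / (x <= y)%R >-> y <= x}.

Lemma near_right0_lt (c : R) : (0 < c)%R ->
  \forall a \near (0 : R)^'+, (0 < a < c)%R.
Proof.
move=> c0; near=> a; apply/andP; split; near: a.
  exact: nbhs_right_gt.
exact: nbhs_right_lt.
Unshelve. all: by end_near. Qed.

Lemma lower_darboux_le_monotone_integral a b : (0 < a)%R ->
  lower_darboux_integral a b h <= monotone_integral h.
Proof.
move=> a0; apply: ge_ereal_sup => _ [s [ps _] <-].
by rewrite lower_darboux_sumE//; exact: right_sum_le_monotone_integral.
Qed.

(** Extending a subdivision on both sides only adds nonnegative terms, so a single
    sum bounds from below the integrals over all larger intervals. This is what
    makes the improper integral a limit along the product filter. *)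
Lemma right_sum_le_lower_darboux a0 s a b : path <%R a0 s ->
  (a < a0)%R -> (last a0 s < b)%R ->
  right_sum h a0 s <= lower_darboux_integral a b h.
Proof.
move=> ps aa0 sb.
have pt : path <%R a (a0 :: rcons s b) by rewrite /= aa0 rcons_path ps.
apply: (@le_trans _ _ (lower_darboux_sum a b h (a0 :: rcons s b))); last first.
  apply: ereal_sup_ubound; exists (a0 :: rcons s b) => //; split=> //.
  by rewrite /= last_rcons.
rewrite lower_darboux_sumE//= right_sum_rcons addeCA leeDl//.
by rewrite adde_ge0// mule_ge0// lee_fin subr_ge0 ltW.
Qed.

Lemma lower_le_upper_darboux a b :
  lower_darboux_integral a b h <= upper_darboux_integral a b h.
Proof.
apply: ge_ereal_sup => _ [s [ps /eqP ls] <-].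
apply: le_ereal_inf_tmp => _ [t [pt /eqP lt] <-].
rewrite lower_darboux_sumE// upper_darboux_sumE//.
by apply: le_right_left_sum; rewrite ?ls ?lt//; exact: path_ltW.
Qed.

Lemma left_sum_grid_le a (e : R) n : (0 < e)%R ->
  left_sum h a (grid a e n) <= right_sum h a (grid a e n) + h a * e%:E.
Proof.
move=> e0; rewrite -left_sum_grid// leeDl// mule_ge0// lee_fin.
exact: ltW.
Qed.

(** On a regular grid of step [w] the upper and lower sums differ by at most
    [h a * w], which is arbitrarily small. *)
Lemma monotone_darboux_integrable a b : (a < b)%R -> h a \is a fin_num ->
  lower_darboux_integral a b h = upper_darboux_integral a b h.
Proof.
move=> ab hfin; apply/eqP; rewrite eq_le lower_le_upper_darboux/=.
apply/lee_addgt0Pr => e e0.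
have ba0 : (0 < b - a)%R by rewrite subr_gt0.
pose c := fine (h a); have c0 : (0 <= c)%R by exact: fine_ge0.
have hc : h a = c%:E by rewrite fineK.
pose n := (Num.truncn (c * (b - a) / e)).+1.
pose w := ((b - a) / n%:R)%R.
have n0 : (0 < n%:R :> R)%R by rewrite ltr0n.
have w0 : (0 < w)%R by rewrite divr_gt0.
have cw : (c * w <= e)%R.
  rewrite /w mulrA ler_pdivrMr// -ler_pdivrMl// mulrC.
  by rewrite ltW// /n truncnS_gt.
have itvg : itv_partition a b (grid a w n).
  split; first exact: path_grid.
  by rewrite last_grid -mulr_natr /w mulfVK ?(gt_eqF n0)// addrC subrK.
have pg := path_grid a n w0.
apply: (@le_trans _ _ (left_sum h a (grid a w n))).
  apply: ereal_inf_lbound; exists (grid a w n) => //.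
  by rewrite upper_darboux_sumE.
apply: (le_trans (left_sum_grid_le _ _ w0)); apply: leeD.
  apply: ereal_sup_ubound; exists (grid a w n) => //.
  by rewrite lower_darboux_sumE.
by rewrite hc -EFinM lee_fin.
Qed.

(** If [h] is infinite at some point of [(0, +oo)] then both Darboux integrals are
    infinite over every interval having that point in its interior, otherwise [h]
    is finite and integrable on each compact subinterval. *)
Lemma monotone_improper_riemann_integral :
  is_improper_riemann_integral h (monotone_integral h).
Proof.
split.
  have [[c [c0 hc]]|hfin] := pselect (exists c, (0 < c)%R /\ h c = +oo).
    exists ([set a | (0 < a < c)%R], [set b | (c < b)%R]) => /=.
      split; last by apply: nbhs_pinfty_gt; exact: num_real.
      exact: near_right0_lt.
    move=> [a b] /= [/andP[a0 ac] cb].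
    have : lower_darboux_integral a b h = +oo.
      apply/eqP; rewrite -leye_eq.
      have -> : +oo = right_sum h ((a + c) / 2)%R [:: c].
        by rewrite /= hc adde0 gt0_mulye// lte_fin; lra.
      by apply: right_sum_le_lower_darboux => //=; rewrite ?andbT; lra.
    move=> lowy; apply/eqP; rewrite eq_le lower_le_upper_darboux lowy.
    by rewrite leey.
  exists ([set a | (0 < a < 1)%R], [set b | (1 < b)%R]) => /=.
    split; last by apply: nbhs_pinfty_gt; exact: num_real.
    exact: near_right0_lt.
  move=> [a b] /= [/andP[a0 a1] b1]; apply: monotone_darboux_integrable.
    exact: lt_trans b1.
  rewrite ge0_fin_numE// ltey; apply/eqP => hy; apply: hfin; by exists a.
have lowlim (r : \bar R) : r < monotone_integral h ->
    \forall ab \near filter_prod (0 : R)^'+ +oo%R,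
      r < lower_darboux_integral ab.1 ab.2 h <= monotone_integral h.
  move=> /ereal_sup_gt[_ [[a0 s] [/= a00 ps] <-]] rs.
  exists ([set a | (0 < a < a0)%R], [set b | (last a0 s < b)%R]) => /=.
    split; last by apply: nbhs_pinfty_gt; exact: num_real.
    exact: near_right0_lt.
  move=> [a b] /= [/andP[a_gt0 aa0] sb].
  rewrite lower_darboux_le_monotone_integral// andbT.
  exact/(lt_le_trans rs)/right_sum_le_lower_darboux.
have J0 : 0 <= monotone_integral h.
  by have := @right_sum_le_monotone_integral h 1 [::]; apply.
case: (monotone_integral h) J0 lowlim => [r| |] // J0 lowlim.
  apply/fine_cvgP; split.
    have : (r - 1)%:E < r%:E by rewrite lte_fin; lra.
    move=> /lowlim; apply: filterS => ab /andP[lo hi].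
    by rewrite fin_real// (lt_trans (ltNyr _) lo) (le_lt_trans hi (ltry _)).
  apply/cvgrPdist_le => e e0.
  have : (r - e)%:E < r%:E by rewrite lte_fin; lra.
  move=> /lowlim; apply: filterS => ab /=.
  case: lower_darboux_integral => [x| |]//=.
    by rewrite lte_fin lee_fin => /andP[lo hi]; rewrite ler_norml; lra.
  by rewrite leye_eq andbF.
apply/cvgeyPgt => A; have := lowlim A%:E (ltry _).
by apply: filterS => ab /andP[].
Qed.

End monotone_integral.

(** * Limits and estimates of integrals *)

Section monotone_integral_theory.
Context {R : realType}.
Implicit Types (phi : R -> \bar R) (a b x y : R) (s : seq R).

Lemma right_sum_cvg (phi_ : nat -> R -> \bar R) phi a s :
  (forall n x, 0 <= phi_ n x) -> (forall x, phi_ n x @[n --> \oo] --> phi x) ->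
  path <=%R a s ->
  right_sum (phi_ n) a s @[n --> \oo] --> right_sum phi a s.
Proof.
move=> phi0 phil; elim: s a => /= [a _|x s ih a /andP[ax xs]].
  exact: cvg_cst.
have phix0 y : 0 <= phi y.
  by apply: cvge_to_ge (phil y) _; exact: nearW.
apply: cvgeD; last exact: ih.
  apply: ge0_adde_def; rewrite inE ?right_sum_ge0 ?mule_ge0// lee_fin.
  by rewrite subr_ge0.
exact: cvgeZr.
Qed.

(** A form of Fatou's lemma. Right sums depend on finitely many values of the
    integrand, so they converge, and the supremum defining the integral is lower
    semicontinuous for pointwise convergence. *)
Lemma monotone_integral_lim_le (phi_ : nat -> R -> \bar R) phi (c : \bar R) :
  (forall n x, 0 <= phi_ n x) -> (forall x, phi_ n x @[n --> \oo] --> phi x) ->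
  (forall n, monotone_integral (phi_ n) <= c) -> monotone_integral phi <= c.
Proof.
move=> phi0 phil Jc; apply: monotone_integral_le => a s a0 ps.
apply: cvge_to_le (right_sum_cvg phi0 phil (path_ltW ps)) _.
apply: nearW => n; apply: le_trans (Jc n).
exact: right_sum_le_monotone_integral.
Qed.

Lemma le_monotone_integral phi psi : (forall x, phi x <= psi x) ->
  monotone_integral phi <= monotone_integral psi.
Proof.
move=> pp; apply: monotone_integral_le => a s a0 ps.
apply: le_trans (right_sum_le_monotone_integral psi a0 ps).
by apply: le_right_sum => //; exact: path_ltW.
Qed.

Lemma monotone_integral_truncated_le phi (c q : R) : (0 <= c)%R -> (0 <= q)%R ->
  (forall x, phi x <= c%:E) -> (forall x, (q < x)%R -> phi x = 0) ->
  monotone_integral phi <= (c * q)%:E.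
Proof.
move=> c0 q0 phic phi0; apply: monotone_integral_le => a s a0 ps.
apply: (@le_trans _ _ (c * Num.max 0 (q - a))%:E); last first.
  by rewrite lee_fin ler_wpM2l// ge_max q0/=; lra.
elim: s a {a0} ps => /= [a _|x s ih a /andP[ax /ih{}ih]].
  by rewrite lee_fin mulr_ge0// le_max lexx.
have [qx|xq] := ltP q x.
  rewrite phi0// mul0e add0e (le_trans ih)// lee_fin ler_wpM2l// ge_max.
  by rewrite !le_max lexx/=; apply/orP; left; lra.
have -> : (c * Num.max 0 (q - a) = c * (x - a) + c * Num.max 0 (q - x))%R.
  by rewrite !max_r; lra.
rewrite [leRHS]EFinD; apply: leeD => //.
by rewrite EFinM lee_wpmul2r// lee_fin; lra.
Qed.

(** The hypotheses on [h] and [G] say that [G] is a nonnegative primitive of [- h]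
    on the nonnegative rationals which vanishes at infinity; those on [phi] say
    that it agrees with [h] up to the values at jumps. *)
Section decomposition.
Variables (h G : rat -> R) (phi : R -> \bar R).
Hypothesis h0 : forall q, (0 <= q)%R -> (0 <= h q)%R.
Hypothesis G0 : forall q, (0 <= q)%R -> (0 <= G q)%R.
Hypothesis GB : forall q r, (0 <= q)%R -> (q < r)%R ->
  ((ratr r - ratr q) * h r <= G q - G r <= (ratr r - ratr q) * h q)%R.
Hypothesis Glim : forall e : R, (0 < e)%R ->
  exists M : rat, forall q, (M < q)%R -> (G q < e)%R.
Hypothesis phi0 : forall x, 0 <= phi x.
Hypothesis h_phi : forall q, (0 <= q)%R -> (h q)%:E <= phi (ratr q).
Hypothesis phi_h : forall q x, (0 <= q)%R -> (ratr q < x)%R ->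
  phi x <= (h q)%:E.

(** The points of the subdivision are real while [G] lives on the rationals. The
    induction therefore splits the increment of [G] at a rational [q] slightly to
    the left of the first point [y], where [h q] bounds [phi y] from above. *)
Lemma right_sum_le_decomposition s a (q0 : rat) : (0 <= q0)%R ->
  (ratr q0 < a)%R -> path <%R a s -> right_sum phi a s <= (G q0)%:E.
Proof.
elim: s a q0 => /= [|y s ih] a q0 q00 q0a; first by rewrite lee_fin G0.
move=> /andP[ay ys].
have phiy := phi_h q00 (lt_trans q0a ay).
pose c := fine (phi y); have c0 : (0 <= c)%R by exact: fine_ge0.
have hc : phi y = c%:E.
  by rewrite fineK// ge0_fin_numE// (le_lt_trans phiy)// ltry.
apply/lee_addgt0Pr => e e0.
have ec0 : (0 < e / (c + 1))%R by rewrite divr_gt0//; lra.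
have [q] : exists q : rat, ratr q \in `]Num.max a (y - e / (c + 1)), y[%R.
  by apply: rat_in_itvoo; rewrite gt_max ay/=; lra.
rewrite in_itv/= gt_max => /andP[/andP[aq eq] qy].
have q0q : (q0 < q)%R by rewrite -(ltr_rat R) (lt_trans q0a).
have q_ge0 : (0 <= q)%R := le_trans q00 (ltW q0q).
apply: (@le_trans _ _ (phi y * (y - a)%:E + (G q)%:E)).
  by rewrite leeD2l// ih.
rewrite hc -EFinM -!EFinD lee_fin.
have cq : (c * (ratr q - a) <= (ratr q - ratr q0) * h q)%R.
  rewrite mulrC; apply: ler_pM => //; [lra|lra|].
  by rewrite -lee_fin -hc phi_h.
have ce : (c * (y - ratr q) <= e)%R.
  apply: (@le_trans _ _ ((c + 1) * (e / (c + 1)))%R).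
    by apply: ler_pM => //; lra.
  by rewrite mulrC divfK // gt_eqF //; lra.
have /andP[Gq _] := GB q00 q0q.
by lra.
Qed.

Lemma decomposition_le_left_sum n (q e : rat) : (0 <= q)%R -> (0 < e)%R ->
  (G q - G (q + e *+ n))%:E <= left_sum phi (ratr q) (grid (ratr q) (ratr e) n).
Proof.
move=> + e0; elim: n q => [|n ih] q q0 /=; first by rewrite addr0 subrr.
have qe0 : (0 <= q + e)%R by rewrite addr_ge0// ltW.
have /(GB q0)/andP[_ Gq] : (q < q + e)%R by rewrite ltrDl.
have := ih _ qe0; rewrite -addrA -mulrS rmorphD/= => {}ih.
have -> : (G q - G (q + e *+ n.+1) =
  (G q - G (q + e)) + (G (q + e) - G (q + e *+ n.+1)))%R by lra.
rewrite [leLHS]EFinD; apply: leeD => //.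
rewrite addrAC subrr add0r.
apply: (@le_trans _ _ (h q * ratr e)%:E).
  by rewrite lee_fin (le_trans Gq)// rmorphD/= mulrC; lra.
by rewrite EFinM lee_wpmul2r ?h_phi// lee_fin ler0q ltW.
Qed.

(** The upper estimate is the previous sum bound at [q = 0]. For the lower one, a
    rational grid of small step [d] starting at [d] is used: [G 0] exceeds [G d]
    by at most [d * h 0], the left and right sums on the grid differ by at most
    [d * h 0] again, and the value of [G] at the end of the grid is small. *)
Lemma monotone_integral_decomposition : monotone_integral phi = (G 0%R)%:E.
Proof.
apply/eqP; rewrite eq_le; apply/andP; split.
  apply: monotone_integral_le => a s a0 ps.
  by apply: right_sum_le_decomposition; rewrite ?rmorph0.
apply/lee_addgt0Pr => e e0.
have e3 : (0 < e / 3)%R by lra.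
have [M GM] := Glim e3.
have hh0 : (0 <= h 0)%R by exact: h0.
have [d] : exists d : rat, ratr d \in `]0%R, e / 3 / (h 0 + 1)[%R.
  by apply: rat_in_itvoo; rewrite divr_gt0//; lra.
rewrite in_itv/= => /andP[d0 de].
have d_gt0 : (0 < d)%R by rewrite -(ltr0q R).
have hd : (h 0 * ratr d <= e / 3)%R.
  move: de; rewrite ltr_pdivlMr; last lra.
  by move=> /ltW; apply: le_trans; rewrite mulrC ler_pM2l//; lra.
pose n := (Num.truncn (M / d)).+1.
have Mn : (M < d + d *+ n)%R.
  rewrite -mulr_natr mulrC (@lt_trans _ _ (n%:R * d)%R)//; last by lra.
  by rewrite -ltr_pdivrMr// truncnS_gt.
have GMn := GM _ Mn.
have dd := decomposition_le_left_sum n (ltW d_gt0) d_gt0.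
have Jd := le_trans dd (left_sum_grid_le phi0 (ratr d) n d0).
have pg := path_grid (ratr d) n d0.
have {}Jd :=
  le_trans Jd (leeD (right_sum_le_monotone_integral phi d0 pg) (lexx _)).
have /andP[_ G0d] := GB (lexx 0%R) d_gt0.
rewrite rmorph0 subr0 in G0d.
have phid : phi (ratr d) * (ratr d)%:E <= (h 0 * ratr d)%:E.
  by rewrite [leRHS]EFinM lee_wpmul2r ?phi_h ?rmorph0// lee_fin ltW.
have {}Jd := le_trans Jd (leeD (lexx _) phid).
apply: (@le_trans _ _ ((G d - G (d + d *+ n)) + (2 * (e / 3)))%:E).
  by rewrite lee_fin; lra.
rewrite EFinD; apply: (le_trans (leeD Jd (lexx _))).
rewrite -addeA leeD2l// -EFinD lee_fin; lra.
Qed.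

End decomposition.

End monotone_integral_theory.

(** * Null sets and uniqueness of Choquet derivatives *)

Section monotone_measure_theory.
Context {R : realType} {d : measure_display} {U : measurableType d}.
Implicit Types (mu nu : set U -> \bar R) (A B : set U) (f g : U -> \bar R).

Lemma measurable_superlevel f (y : \bar R) : measurable_fun [set: U] f ->
  measurable [set x | y <= f x].
Proof.
by move=> mf; rewrite -[X in measurable X]setTI; exact: emeasurable_fun_c_infty.
Qed.

Lemma measurable_sublevel f (y : \bar R) : measurable_fun [set: U] f ->
  measurable [set x | f x <= y].
Proof.
by move=> mf; rewrite -[X in measurable X]setTI; exact: emeasurable_fun_infty_c.
Qed.

Lemma choquet_monotone_integral nu A f :
  monotone_measure nu -> measurable_fun [set: U] f -> measurable A ->
  is_choquet_integral nu A f
    (monotone_integral (fun a : R => nu ([set x | a%:E <= f x] `&` A))).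
Proof.
move=> [_ nu0 numon] mf mA.
have mfA (y : \bar R) : measurable ([set x | y <= f x] `&` A).
  by apply: measurableI => //; exact: measurable_superlevel.
apply: monotone_improper_riemann_integral => [a|a b ab]; first exact/nu0/mfA.
by apply: numon => // x [/= bx Ax]; split=> //=; apply: le_trans bx; rewrite lee_fin.
Qed.

Lemma lower_continuous_exhaustion mu (V : nat -> set U) A :
  lower_continuous mu -> (forall n, measurable (V n)) ->
  (forall n, V n `<=` V n.+1) -> \bigcup_n V n = [set: U] -> measurable A ->
  mu (A `&` V n) @[n --> \oo] --> mu A.
Proof.
move=> lc mV ndV VT mA; have := lc (fun n => A `&` V n).
rewrite -setI_bigcupr VT setIT; apply; first by move=> n; exact: measurableI.
apply/nondecreasing_seqP => n; apply/subsetPset; exact: setIS.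
Qed.

(** Null-additivity alone gives finite unions; lower continuity gives the limit. *)
Lemma null_bigcup nu (N : nat -> set U) : monotone_measure nu ->
  null_additive nu -> lower_continuous nu -> (forall n, measurable (N n)) ->
  (forall n, nu (N n) = 0) -> nu (\bigcup_n N n) = 0.
Proof.
move=> [nu0 _ _] na lc mN N0; rewrite -bigcup_bigsetU_bigcup.
have mB n : measurable (\big[setU/set0]_(i < n) N i) by exact: bigsetU_measurable.
have B0 n : nu (\big[setU/set0]_(i < n) N i) = 0.
  elim: n => [|n ih]; first by rewrite big_ord0.
  by rewrite big_ord_recr/= (na _ _ (mB n) (mN n) (N0 n)).
have ndB : nondecreasing_seq (fun n => \big[setU/set0]_(i < n.+1) N i).
  by apply/nondecreasing_seqP => n; apply/subsetPset; exact: subset_bigsetU.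
have := lc _ (fun n => mB n.+1) ndB; under eq_fun do rewrite B0.
by move=> /cvg_unique; apply => //; exact: cvg_cst.
Qed.

Lemma null_countable_bigcup (T : countType) nu (N : T -> set U) B :
  monotone_measure nu -> null_additive nu -> lower_continuous nu ->
  (forall t, measurable (N t)) -> (forall t, nu (N t) = 0) ->
  measurable B -> B `<=` \bigcup_t N t -> nu B = 0.
Proof.
move=> nu_mm na lc mN N0 mB BN; have [nu0 nu_ge0 numon] := nu_mm.
pose F n := if unpickle n is Some t then N t else set0.
have mF n : measurable (F n) by rewrite /F; case: unpickle.
have F0 : nu (\bigcup_n F n) = 0.
  by apply: null_bigcup => // n; rewrite /F; case: unpickle.
apply/eqP; rewrite eq_le nu_ge0// andbT -F0; apply: numon => //.
  exact: bigcupT_measurable.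
by move=> x /BN[t _ Ntx]; exists (pickle t) => //; rewrite /F pickleK.
Qed.

Section uniqueness.
Variables (mu nu : set U -> \bar R) (V : nat -> set U).
Hypotheses (nu_mm : monotone_measure nu) (nu_lc : lower_continuous nu).
Hypothesis nu_na : null_additive nu.
Hypothesis mV : forall n, measurable (V n).
Hypothesis VT : \bigcup_n V n = [set: U].
Hypothesis V_fin : forall n, nu (V n) < +oo.

(** Here [f] forces [mu E <= q * nu E] and [g] forces [r * nu E <= mu E], which is
    impossible for finite [nu E > 0]. *)
Lemma choquet_derivative_separated f g (q r : R) n : (0 <= q)%R -> (q < r)%R ->
  choquet_derivative mu nu f -> choquet_derivative mu nu g ->
  nu ([set x | f x <= q%:E] `&` [set x | r%:E <= g x] `&` V n) = 0.
Proof.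
move=> q0 qr [f0 mf _ fE] [g0 mg _ gE]; have [nu0 nu_ge0 numon] := nu_mm.
set E := _ `&` V n.
have mE : measurable E.
  apply: measurableI => //; apply: measurableI.
    exact: measurable_sublevel.
  exact: measurable_superlevel.
pose c := fine (nu E); have c0 : (0 <= c)%R by apply/fine_ge0/nu_ge0.
have nuE : nu E = c%:E.
  rewrite fineK// ge0_fin_numE ?nu_ge0//.
  by apply: le_lt_trans (V_fin n); apply: numon => // x [].
have muf := is_choquet_integral_unique (fE E mE)
  (choquet_monotone_integral nu_mm mf mE).
have mug := is_choquet_integral_unique (gE E mE)
  (choquet_monotone_integral nu_mm mg mE).
have hi : mu E <= (c * q)%:E.
  rewrite muf; apply: monotone_integral_truncated_le => // [x|x qx].
    rewrite -nuE; apply: numon => //.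
    by apply: measurableI => //; exact: measurable_superlevel.
  rewrite -nu0; congr nu; apply/seteqP; split=> // y [/= xf [[/= fq _] _]].
  by have := le_trans xf fq; rewrite lee_fin leNgt qx.
(* The single interval from [(r - q) / 2] to [r] has length [(r + q) / 2 > q],
   enough to contradict the upper bound. *)
have a0 : (0 < (r - q) / 2)%R by lra.
have par : path <%R ((r - q) / 2)%R [:: r] by rewrite /= andbT; lra.
have := right_sum_le_monotone_integral
  (fun a : R => nu ([set x | a%:E <= g x] `&` E)) a0 par.
rewrite -mug /= adde0.
have -> : [set x | r%:E <= g x] `&` E = E.
  by apply/seteqP; split=> [y []//|y Ey]; split=> //; case: Ey => -[].
rewrite nuE -EFinM => lo; have := le_trans lo hi; rewrite lee_fin => {}lo.
congr EFin; apply/eqP; rewrite eq_le c0 andbT -(pmulr_lle0 _ a0); lra.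
Qed.

Lemma choquet_derivative_lt_null f g :
  choquet_derivative mu nu f -> choquet_derivative mu nu g ->
  measurable [set x | f x < g x] /\ nu [set x | f x < g x] = 0.
Proof.
move=> df dg; have [f0 mf _ _] := df; have [g0 mg _ _] := dg.
have [nu0 _ _] := nu_mm.
have mfg : measurable [set x | f x < g x].
  by rewrite -[X in measurable X]setTI; exact: measurable_lte.
split=> //.
(* Two rationals are needed between [f x] and [g x]: with a single one, the
   bounds on [mu E] would not be separated. *)
pose N (t : rat * rat * nat) := let: (q, r, n) := t in
  if (0 <= q < r)%R then
    [set x | f x <= (ratr q : R)%:E] `&` [set x | (ratr r : R)%:E <= g x]
      `&` V n
  else set0.
apply: (@null_countable_bigcup _ nu N) => //.
- move=> [[q r] n] /=; case: ifP => // _; apply: measurableI => //.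
  apply: measurableI; first exact: measurable_sublevel.
  exact: measurable_superlevel.
- move=> [[q r] n] /=; case: ifPn => // /andP[q0 qr].
  by apply: choquet_derivative_separated => //; rewrite ?ler0q ?ltr_rat.
- move=> x /= fg.
  have [n _ Vnx] : (\bigcup_n V n) x by rewrite VT.
  have := f0 x; case fx: (f x) fg => [y| |]// yg; last first.
    by move: yg; rewrite ltNge leey.
  rewrite lee_fin => y0.
  have [z yz zg] : exists2 z : R, (y < z)%R & z%:E <= g x.
    case: (g x) yg => [z| |]//; first by rewrite lte_fin => yz; exists z.
    by move=> _; exists (y + 1)%R; rewrite ?leey//; lra.
  have yz2 : (y < (y + z) / 2)%R by lra.
  have zy2 : ((y + z) / 2 < z)%R by lra.
  have [q] := rat_in_itvoo yz2; rewrite in_itv/= => /andP[yq qyz].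
  have [r] := rat_in_itvoo zy2; rewrite in_itv/= => /andP[yzr rz].
  exists (q, r, n) => //=.
  rewrite -(ler0q R) -(ltr_rat R) (le_trans y0 (ltW yq)) (lt_trans qyz yzr)/=.
  split=> //; split=> /=; first by rewrite fx lee_fin ltW.
  by apply: le_trans zg; rewrite lee_fin ltW.
Qed.

Lemma choquet_derivative_unique f g :
  choquet_derivative mu nu f -> choquet_derivative mu nu g ->
  nu [set x | f x != g x] = 0.
Proof.
move=> df dg.
have [mfg fg0] := choquet_derivative_lt_null df dg.
have [mgf gf0] := choquet_derivative_lt_null dg df.
have -> : [set x | f x != g x] = [set x | f x < g x] `|` [set x | g x < f x].
  by apply/seteqP; split=> x /=; rewrite neq_lt => /orP.
by rewrite nu_na.
Qed.

End uniqueness.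
End monotone_measure_theory.

(** * The density built from the decomposition *)

Section existence.
Context {R : realType} {d : measure_display} {U : measurableType d}.
Variables (mu nu : set U -> \bar R) (A_ : rat -> set U).
Hypotheses (mu_mm : monotone_measure mu) (nu_mm : monotone_measure nu).
Hypothesis decA : decomposition_property mu nu A_.

Definition level_density (x : U) : \bar R :=
  ereal_sup [set (ratr q)%:E | q in [set q : rat | (0 <= q)%R /\ A_ q x]].

Lemma level_density_ge (q : rat) x : (0 <= q)%R -> A_ q x ->
  (ratr q)%:E <= level_density x.
Proof. by move=> q0 Aqx; apply: ereal_sup_ubound; exists q. Qed.

Lemma level_density_gt (q : rat) x : (0 <= q)%R ->
  (ratr q)%:E < level_density x -> A_ q x.
Proof.
have [_ ni _ _] := decA.
move=> q0 /ereal_sup_gt[_ [r [r0 Arx] <-]]; rewrite lte_fin ltr_rat => qr.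
exact: ni q0 qr _ Arx.
Qed.

Lemma level_density_ge0 x : 0 <= level_density x.
Proof.
have [_ _ A0 _] := decA.
by have := @level_density_ge 0%R x; rewrite rmorph0 A0; apply.
Qed.

Lemma measurable_level_density : measurable_fun [set: U] level_density.
Proof.
have [mA _ _ _] := decA.
apply: (measurability _ (ErealGenOInfty.measurableE R)).
move=> _ [_ [y ->] <-]; rewrite setTI.
have -> : level_density @^-1` `]y%:E, +oo[ =
    \bigcup_q (if (0 <= q)%R && (y < ratr q)%R then A_ q else set0).
  apply/seteqP; split=> x; rewrite /preimage/= in_itv/= andbT.
    move=> /ereal_sup_gt[_ [q [q0 Aqx] <-]]; rewrite lte_fin => yq.
    by exists q => //; rewrite q0 yq.
  move=> [q _]; case: ifP => // /andP[q0 yq] Aqx.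
  by apply: lt_le_trans (level_density_ge q0 Aqx); rewrite lte_fin.
by apply: bigcupT_measurable_rat => q; case: ifP => // /andP[q0 _]; exact: mA.
Qed.

(** The nonnegativity of [G q], that is [q * h q <= m q], is the decomposition
    inequality between [q] and [r] in the limit where [r] goes to infinity. *)
Lemma choquet_level_density A : measurable A -> mu A < +oo -> nu A < +oo ->
  (forall e : R, (0 < e)%R -> exists M : rat, forall q, (M < q)%R ->
     mu (A `&` A_ q) < e%:E /\ nu (A `&` A_ q) < e%:E) ->
  monotone_integral (fun a : R => nu ([set x | a%:E <= level_density x] `&` A))
    = mu A.
Proof.
move=> mA muA nuA Alim.
have [mA_ niA_ A0 dec] := decA.
have [_ mu0 mumon] := mu_mm; have [_ nu0 numon] := nu_mm.
have mAq q : (0 <= q)%R -> measurable (A `&` A_ q).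
  by move=> q0; apply: measurableI => //; exact: mA_.
pose m q := fine (mu (A `&` A_ q)); pose h q := fine (nu (A `&` A_ q)).
have muq q : (0 <= q)%R -> mu (A `&` A_ q) = (m q)%:E.
  move=> q0; rewrite fineK// ge0_fin_numE; last exact/mu0/mAq.
  by apply: le_lt_trans muA; apply: mumon => //; exact: mAq.
have nuq q : (0 <= q)%R -> nu (A `&` A_ q) = (h q)%:E.
  move=> q0; rewrite fineK// ge0_fin_numE; last exact/nu0/mAq.
  by apply: le_lt_trans nuA; apply: numon => //; exact: mAq.
have h0 q : (0 <= q)%R -> (0 <= h q)%R by move=> q0; exact/fine_ge0/nu0/mAq.
have m0 q : (0 <= q)%R -> (0 <= m q)%R by move=> q0; exact/fine_ge0/mu0/mAq.
have decR q r : (0 <= q)%R -> (q < r)%R ->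
    (ratr q * (h q - h r) <= m q - m r <= ratr r * (h q - h r))%R.
  move=> q0 qr; have r0 := le_trans q0 (ltW qr).
  have := dec A mA muA nuA q r q0 qr.
  by rewrite !muq// !nuq// -!EFinB -!EFinM !lee_fin => -[-> ->].
have limR (e : R) : (0 < e)%R ->
    exists M : rat, forall q, (M < q)%R -> (0 <= q)%R ->
      (m q < e)%R /\ (h q < e)%R.
  move=> /Alim[M HM]; exists M => q /HM + q0.
  by rewrite muq// nuq// !lte_fin.
pose G q := (m q - ratr q * h q)%R.
have <- : (G 0%R)%:E = mu A.
  by rewrite /G rmorph0 mul0r subr0 -muq// A0 setIT.
apply: (@monotone_integral_decomposition R h G) => //.
- move=> q q0; rewrite /G subr_ge0; apply/ler_addgt0Pr => e e0.
  have q1 : (0 < ratr q + 1 :> R)%R.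
    by have : (0 <= ratr q :> R)%R; [rewrite ler0q|lra].
  have [M HM] := limR _ (divr_gt0 e0 q1).
  pose r := (Num.max M q + 1)%R.
  have /andP[Mr qr] : (M < r)%R && (q < r)%R.
    by rewrite -gt_max /r ltrDl.
  have r0 : (0 <= r)%R := le_trans q0 (ltW qr).
  have [_ hr] := HM r Mr r0.
  have /andP[lo _] := decR q r q0 qr.
  have qhr : (ratr q * h r <= e)%R.
    apply: (@le_trans _ _ ((ratr q + 1) * (e / (ratr q + 1)))%R); last first.
      by rewrite mulrC divfK// gt_eqF.
    by apply: ler_pM => //; [rewrite ler0q|exact: h0|lra|exact: ltW].
  have := m0 r r0; lra.
- move=> q r q0 qr; have /andP[lo hi] := decR q r q0 qr.
  by rewrite /G; apply/andP; split; lra.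
- move=> e /limR[M HM]; exists (Num.max M 0%R) => q.
  rewrite gt_max => /andP[Mq q_gt0].
  have [me _] := HM q Mq (ltW q_gt0); apply: le_lt_trans me.
  by rewrite /G lerBlDr lerDl mulr_ge0 ?ler0q ?h0// ltW.
- move=> x; apply: nu0; apply: measurableI => //.
  exact/measurable_superlevel/measurable_level_density.
- move=> q q0; rewrite -nuq//; apply: numon; first exact: mAq.
    apply: measurableI => //.
    exact/measurable_superlevel/measurable_level_density.
  by move=> x [Ax Aqx]; split=> //=; exact: level_density_ge.
- move=> q x q0 qx; rewrite -nuq//; apply: numon; last 2 first.
    exact: mAq.
    move=> y [/= xy Ay]; split=> //; apply: level_density_gt => //.
    by apply: lt_le_trans xy; rewrite lte_fin.
  apply: measurableI => //.
  exact/measurable_superlevel/measurable_level_density.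
Qed.

Variable V : nat -> set U.
Hypotheses (mu_lc : lower_continuous mu) (nu_lc : lower_continuous nu).
Hypothesis nu_na : null_additive nu.
Hypothesis mV : forall n, measurable (V n).
Hypothesis ndV : forall n, V n `<=` V n.+1.
Hypothesis VT : \bigcup_n V n = [set: U].
Hypothesis V_fin : forall n, mu (V n) < +oo /\ nu (V n) < +oo.
Hypothesis V_lim : forall n (e : R), (0 < e)%R ->
  exists M : rat, forall q, (M < q)%R ->
    mu (A_ q `&` V n) < e%:E /\ nu (A_ q `&` V n) < e%:E.

(** The set [{f = +oo}] lies in every [A_ q], whose traces on [V n] have
    arbitrarily small measure. *)
Lemma level_density_infty_null : nu [set x | level_density x = +oo] = 0.
Proof.
have [mA_ _ _ _] := decA; have [_ nu0 numon] := nu_mm.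
have mI : measurable [set x | level_density x = +oo].
  rewrite (_ : [set x | _] = [set x | +oo <= level_density x]).
    exact/measurable_superlevel/measurable_level_density.
  by apply/seteqP; split=> x /=; rewrite leye_eq => /eqP.
have mIV n : measurable ([set x | level_density x = +oo] `&` V n).
  exact: measurableI.
rewrite -[X in nu X]setIT -VT setI_bigcupr; apply: null_bigcup => // n.
apply/eqP; rewrite eq_le nu0// andbT; apply/lee_addgt0Pr => e e0; rewrite add0e.
have [M HM] := V_lim n e0.
pose q := (Num.max M 0 + 1)%R.
have /andP[Mq /ltW q0] : (M < q)%R && (0 < q)%R.
  by rewrite -gt_max /q ltrDl.
have [_ /ltW] := HM q Mq; apply: le_trans; apply: numon => //.
  by apply: measurableI => //; exact: mA_.
by move=> x [/= fy Vx]; split=> //; apply: level_density_gt; rewrite ?fy ?ltry.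
Qed.

(** The formula holds on each [A `&` V n], where both measures are finite, and
    [n] goes to infinity on both sides: lower continuity of [nu] applies to each
    superlevel set, lower continuity of [mu] to [A] itself. *)
Lemma choquet_derivative_level_density : choquet_derivative mu nu level_density.
Proof.
split; [exact: level_density_ge0|exact: measurable_level_density|
  exact: level_density_infty_null|].
have [mA_ _ _ _] := decA.
have [_ mu0 mumon] := mu_mm; have [_ nu0 numon] := nu_mm.
move=> A mA; have mf := measurable_level_density.
have mAV n : measurable (A `&` V n) by exact: measurableI.
have mfA B x : measurable B ->
    measurable ([set y | x%:E <= level_density y] `&` B).
  by move=> mB; apply: measurableI => //; exact: measurable_superlevel.
have Jn n : monotone_integral (fun a : R =>
    nu ([set x | a%:E <= level_density x] `&` (A `&` V n))) = mu (A `&` V n).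
  have [muV nuV] := V_fin n.
  apply: choquet_level_density => //.
  - by apply: le_lt_trans muV; apply: mumon.
  - by apply: le_lt_trans nuV; apply: numon.
  - move=> e /(V_lim n)[M HM]; exists (Num.max M 0%R) => q.
    rewrite gt_max => /andP[/HM[mue nue] /ltW q0].
    have mAq := mA_ q q0.
    have sub : A `&` V n `&` A_ q `<=` A_ q `&` V n by move=> x [[]].
    split; [apply: le_lt_trans mue; apply: mumon => //|
            apply: le_lt_trans nue; apply: numon => //];
      by apply: measurableI.
suff <- : monotone_integral
    (fun a : R => nu ([set x | a%:E <= level_density x] `&` A)) = mu A.
  exact: choquet_monotone_integral.
apply/eqP; rewrite eq_le; apply/andP; split.
  apply: (@monotone_integral_lim_le _ (fun n (a : R) =>
    nu ([set x | a%:E <= level_density x] `&` (A `&` V n)))).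
  - by move=> n x; exact/nu0/mfA.
  - move=> x; under eq_fun do rewrite setIA.
    by apply: lower_continuous_exhaustion => //; exact: mfA.
  - by move=> n; rewrite Jn; apply: mumon.
apply: cvge_to_le (lower_continuous_exhaustion mu_lc mV ndV VT mA) _.
apply: nearW => n; rewrite -Jn; apply: le_monotone_integral => x.
by apply: numon; [exact: mfA|exact: mfA|move=> y [? []]].
Qed.

End existence.

Theorem theorem4p2 (R : realType) (d : measure_display) (U : measurableType d)
    (mu nu : set U -> \bar R)
    (mu_mm : monotone_measure mu) (nu_mm : monotone_measure nu)
    (mu_sfin : mm_sigma_finite mu) (nu_sfin : mm_sigma_finite nu)
    (mu_lc : lower_continuous mu) (nu_lc : lower_continuous nu)
    (nu_na : null_additive nu)
    (U_ : nat -> set U)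
    (mU_ : forall n, measurable (U_ n))
    (ndU_ : forall n, U_ n `<=` U_ n.+1)
    (bigcupU_ : \bigcup_n U_ n = [set: U])
    (U_fin : forall n, mu (U_ n) < +oo /\ nu (U_ n) < +oo)
    (A_ : rat -> set U)
    (decA_ : decomposition_property mu nu A_)
    (limA_ : forall n,
      maxe (mu (A_ a `&` U_ n)) (nu (A_ a `&` U_ n)) @[a --> +oo%R] --> 0) :
  exists f : U -> \bar R,
    choquet_derivative mu nu f /\
    forall g : U -> \bar R, choquet_derivative mu nu g ->
      nu [set x | f x != g x] = 0.
Proof.
have limU n (e : R) : (0 < e)%R -> exists M : rat, forall q, (M < q)%R ->
    mu (A_ q `&` U_ n) < e%:E /\ nu (A_ q `&` U_ n) < e%:E.
  move=> e0; have : nbhs (0 : \bar R) [set y | y < e%:E].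
    by apply: open_ereal_lt'; rewrite lte_fin.
  move=> /(limA_ n)[M [_ HM]]; exists M => q /HM /=.
  by rewrite gt_max => /andP.
have df := choquet_derivative_level_density
  mu_mm nu_mm decA_ mu_lc nu_lc nu_na mU_ ndU_ bigcupU_ U_fin limU.
exists (level_density A_); split=> // g dg.
apply: choquet_derivative_unique df dg => // n; exact: (U_fin n).2.
Qed.
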